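(* Let $G$ be a separable metrizable topological group, $K$ a subgroup of $G$ and $(X,\theta)$ a separable metrizable $K$-space such that $\theta$ is nice. Then $G\times_KX$ is metrizable under any one of the following conditions: (i) $K*X$ is closed in $G\times X$; (ii) $G\times_KX$ is $T_1$, $X$ is locally compact and $R$ is closed in $(K\times X)^2$, where $R$ is the equivalence relation on $K\times X$ given by $(g,x)R(h,y)$ if and only if $x\in X_{g^{-1}h}$ and $\theta_{h^{-1}g}(x)=y$.
   Context: Partial actions. A partial action of a group $G$ (identity $e$) on a set $X$ is a map $\theta:G*X\to X$, $(g,x)\mapsto g\cdot x$, defined on a subset $G*X\subseteq G\times X$ (write $\exists\, g\cdot x$ for $(g,x)\in G*X$), such that for all $g,h\in G$, $x\in X$: (PA1) if $\exists\, g\cdot x$ then $\exists\, g^{-1}\cdot(g\cdot x)$ and $g^{-1}\cdot(g\cdot x)=x$; (PA2) if $\exists\, g\cdot(h\cdot x)$ then $\exists\,(gh)\cdot x$ and $g\cdot(h\cdot x)=(gh)\cdot x$; (PA3) $\exists\, e\cdot x$ and $e\cdot x=x$. Put $X_g=\{x\in X:\exists\, g^{-1}\cdot x\}$, $\theta_g:X_{g^{-1}}\to X_g$, $x\mapsto g\cdot x$. If $G$ is a topological group and $X$ a topological space, $\theta$ is topological if every $X_g$ is open in $X$ and every $\theta_g$ is a homeomorphism; continuous if $\theta$ is continuous for the subspace topology on $G*X\subseteq G\times X$; nice if it is continuous and $G*X$ is open in $G\times X$. All topological groups are Hausdorff and all partial actions are topological. A $G$-space is a pair $(X,\theta)$ with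 $\theta$ a continuous (topological) partial action of $G$ on the topological space $X$. These notions are applied to the group $K$ with the subspace topology (so niceness means $K*X$ is open in $K\times X$). Twisted product. For a subgroup $K\le G$ and a $K$-space $(X,\theta)$, $G\times_KX$ is the quotient space of $G\times X$ by the equivalence relation whose classes are $[g,x]_K=\{(gk^{-1},\theta(k,x)):k\in K^x\}$, where $K^x=\{k\in K:(k,x)\in K*X\}$. *)

(* Defs.v *)
From HB Require Import structures.
From mathcomp Require Import all_boot all_order all_algebra.
From mathcomp Require Import all_classical all_reals all_analysis.
Set Implicit Arguments.
Unset Strict Implicit.
Unset Printing Implicit Defensive.
Import Order.TTheory GRing.Theory Num.Theory.

Local Open Scope classical_set_scope.
Local Open Scope group_scope.
Local Open Scope quotient_scope.

Definition separable (T : topologicalType) : Prop :=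
  exists2 S : set T, countable S & dense S.

Definition is_metric (R : realType) (T : Type) (d : T -> T -> R) : Prop :=
  [/\ forall x y, (0 <= d x y)%R,
      forall x y, d x y = 0%R <-> x = y,
      forall x y, d x y = d y x
    & forall x y z, (d x z <= d x y + d y z)%R].

(* [metricType] carries a chosen distance; metrizability is the mere existence
   of one that induces the given topology. *)
Definition metrizable (R : realType) (T : topologicalType) : Prop :=
  exists2 d : T -> T -> R, is_metric d &
    forall A : set T, open A <->
      forall x, A x -> exists2 e : R, (0 < e)%R & [set y | (d x y < e)%R] `<=` A.

(* [f] restricts to a homeomorphism from [A] onto [B], both with the subspace
   topology; the values of [f] outside [A] play no role. *)
Definition homeo_on (T U : topologicalType) (A : set T) (B : set U)
    (f : T -> U) : Prop :=
  [/\ set_bij A B f, {within A, continuous f} &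
      exists2 f' : U -> T, {within B, continuous f'} & {in A, cancel f f'}].

HB.mixin Record isTopologicalGroup G & Topological G & monoid.Group G := {
  mulg_continuous : continuous (fun p : G * G => p.1 * p.2);
  invg_continuous : continuous (fun g : G => g^-1);
  topgroup_hausdorff : hausdorff_space G
}.

#[short(type="topologicalGroupType")]
HB.structure Definition TopologicalGroup :=
  {G of Topological G & monoid.Group G & isTopologicalGroup G}.

Section Subgroup.
Context {G : topologicalGroupType} (K : groupClosed G).

Definition subgroup_type : Type := {g : G | g \in K}.

HB.instance Definition _ := SubType.copy subgroup_type {g : G | g \in K}.
HB.instance Definition _ := [Choice of subgroup_type by <:].

Fact subgroup_closed : group_closed (fun g : G => g \in K).
Proof.
split; first exact: gpred1.
by move=> x y xK yK; rewrite -topredE /=; apply: gpredM => //; exact: gpredVr.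
Qed.

HB.instance Definition _ :=
  SubChoice_isSubGroup.Build G _ subgroup_type subgroup_closed.

HB.instance Definition _ :=
  Topological.copy subgroup_type (initial_topology (val : subgroup_type -> G)).

Lemma subgroup_val_continuous : continuous (val : subgroup_type -> G).
Proof. exact: initial_continuous. Qed.

Lemma subgroup_into_continuous (T : topologicalType) (f : T -> subgroup_type) :
  continuous (val \o f) -> continuous f.
Proof.
move=> /continuousP cf; apply/continuousP => _ [B oB <-].
by rewrite -comp_preimage; exact: cf.
Qed.

Fact subgroup_mulg_continuous :
  continuous (fun p : subgroup_type * subgroup_type => p.1 * p.2).
Proof.
apply: subgroup_into_continuous => -[x y].
have cv (h : subgroup_type * subgroup_type -> subgroup_type) :
    {for (x, y), continuous h} -> {for (x, y), continuous (val \o h)}.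
  by move=> ch; apply: continuous_comp ch _; exact: subgroup_val_continuous.
have := @continuous_comp _ _ _
  (fun p : subgroup_type * subgroup_type => (val p.1, val p.2))
  (fun p : G * G => p.1 * p.2) (x, y).
apply; last exact: mulg_continuous.
by apply: cvg_pair; apply: cv; [exact: cvg_fst|exact: cvg_snd].
Qed.

Fact subgroup_invg_continuous : continuous (fun k : subgroup_type => k^-1).
Proof.
apply: subgroup_into_continuous => x.
exact: (@continuous_comp subgroup_type G G (val : subgroup_type -> G) _ x
  (@subgroup_val_continuous x) (@invg_continuous G _)).
Qed.

Fact subgroup_hausdorff : hausdorff_space subgroup_type.
Proof.
move=> x y xy; apply: val_inj; apply: topgroup_hausdorff => A B Ax By.
have [z [Az Bz]] := xy _ _ (subgroup_val_continuous Ax)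
  (subgroup_val_continuous By).
by exists (val z).
Qed.

HB.instance Definition _ := isTopologicalGroup.Build subgroup_type
  subgroup_mulg_continuous subgroup_invg_continuous subgroup_hausdorff.

End Subgroup.

(* [pdom] is H * X, the domain of the partial action; the values of [pact]
   outside of it are irrelevant. *)
Record partial_action (H : groupType) (X : Type) := PartialAction {
  pdom : set (H * X);
  pact : H -> X -> X;
  pactV : forall g x, pdom (g, x) ->
    pdom (g^-1, pact g x) /\ pact g^-1 (pact g x) = x;
  pactM : forall g h x, pdom (h, x) -> pdom (g, pact h x) ->
    pdom (g * h, x) /\ pact g (pact h x) = pact (g * h) x;
  pact1 : forall x, pdom (1, x) /\ pact 1 x = x
}.

(* X_g *)
Definition pset (H : groupType) (X : Type) (theta : partial_action H X)
    (g : H) : set X :=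
  [set x | pdom theta (g^-1, x)].

Section TopologicalPartialAction.
Context {H : topologicalGroupType} {X : topologicalType}.
Variable theta : partial_action H X.

Definition topological_paction : Prop :=
  forall g : H, open (pset theta g) /\
    homeo_on (pset theta g^-1) (pset theta g) (pact theta g).

Definition continuous_paction : Prop :=
  {within pdom theta, continuous (fun p : H * X => pact theta p.1 p.2)}.

Definition nice_paction : Prop :=
  continuous_paction /\ open (pdom theta).

(* [(X, theta)] is an H-space. *)
Definition is_Gspace : Prop := topological_paction /\ continuous_paction.

(* the relation R of the enveloping space *)
Definition globalization_rel (p q : H * X) : Prop :=
  pset theta (p.1^-1 * q.1) p.2 /\ pact theta (q.1^-1 * p.1) p.2 = q.2.

Definition globalization_graph : set ((H * X) * (H * X)) :=
  [set pq | globalization_rel pq.1 pq.2].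

End TopologicalPartialAction.

Section TwistedProduct.
Context {G : topologicalGroupType} {K : groupClosed G} {X : topologicalType}.
Variable theta : partial_action (subgroup_type K) X.

(* K * X as a subset of G x X *)
Definition pdom_in : set (G * X) :=
  [set (val p.1, p.2) | p in pdom theta].

(* [q] belongs to the class [g, x]_K, where p = (g, x) *)
Definition twisted_class (p : G * X) : set (G * X) :=
  [set (p.1 * (val k)^-1, pact theta k p.2) | k in [set k | pdom theta (k, p.2)]].

Definition twisted_rel : rel (G * X) := fun p q => `[< twisted_class p q >].

Fact twisted_refl : reflexive twisted_rel.
Proof.
move=> [g x]; apply/asboolP; have [d e] := pact1 theta x.
exists 1 => //; congr pair => //.
by rewrite -[LHS]/(g * 1^-1) monoid.invg1 monoid.mulg1.
Qed.

Fact twisted_sym : symmetric twisted_rel.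
Proof.
suff H p q : twisted_rel p q -> twisted_rel q p by move=> p q; apply/idP/idP => /H.
case: p => g x /asboolP[k /= dk <-]; apply/asboolP.
have [dk' e] := pactV dk.
exists k^-1 => //; congr pair => //.
by rewrite -[LHS]/(g / val k / (val k)^-1) monoid.invgK monoid.mulgVK.
Qed.

Fact twisted_trans : transitive twisted_rel.
Proof.
move=> q [g x] r /asboolP[k /= dk <-] /asboolP[h /= dh <-]; apply/asboolP.
have [dhk e] := pactM dk dh.
exists (h * k) => //; congr pair => //.
by rewrite -[LHS]/(g / (val h * val k)) monoid.invgM monoid.mulgA.
Qed.

Definition twisted_equiv : equiv_rel (G * X) :=
  EquivRel twisted_rel twisted_refl twisted_sym twisted_trans.

Definition twisted_product : topologicalType :=
  quotient_topology {eq_quot twisted_equiv}.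

End TwistedProduct.

(* Main.v *)
Require Import Defs.
From HB Require Import structures.
From mathcomp Require Import all_boot all_order all_algebra.
From mathcomp Require Import all_classical all_reals all_analysis.
From mathcomp Require Import lra.
Local Open Scope classical_set_scope.

(* Since theta is nice, the projection of G x X onto the twisted product is
   open, so the latter is second countable, and by Urysohn's metrization theorem
   it is enough to see that it is regular and T1.  If (h, y) is a limit of
   points equivalent to points of a small neighbourhood U x V of (g, x), fix one
   such point, moved into U x V by k0 in K; every other one, moved by k, has
   k0 k^-1 close to 1, so that by niceness k0 also moves it close to x.  It
   remains to pass to the limit: k0 y must be defined and close to x.  Under (i)
   the domain of k0 is closed; under (ii) its graph is closed and V may be taken
   relatively compact. *)

Set Implicit Arguments.
Unset Strict Implicit.
Unset Printing Implicit Defensive.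
Import Order.TTheory GRing.Theory Num.Theory numFieldNormedType.Exports.

Local Open Scope ring_scope.

(** * Topological consequences of metrizability *)

Section Metrizable.
Context {R : realType} {T : topologicalType}.

Lemma metrizable_nbhs : metrizable R T ->
  exists2 d : T -> T -> R, is_metric d &
    forall x V, nbhs x V <-> exists2 e : R, 0 < e & [set y | d x y < e] `<=` V.
Proof.
case=> d md dopen; exists d => //; have [_ d0 _ dtri] := md.
move=> x V; split=> [|[e e0 eV]].
  rewrite nbhsE => -[U [/dopen oU Ux] UV]; have [e e0 eU] := oU x Ux.
  by exists e => //; exact: subset_trans UV.
rewrite nbhsE; exists [set y | d x y < e] => //; split; last first.
  by rewrite /= (iffRL (d0 x x)).
apply/dopen => y /= xye; exists (e - d x y); first by rewrite subr_gt0.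
by move=> z /= yz; rewrite (le_lt_trans (dtri x y z))// -ltrBrDl.
Qed.

Lemma metrizable_regular : metrizable R T -> regular_space T.
Proof.
move=> /metrizable_nbhs[d [_ _ dsym dtri] dnbhs] x V /dnbhs[e e0 eV].
exists [set y | d x y < e / 2].
  by apply/dnbhs; exists (e / 2); rewrite ?divr_gt0.
move=> y clVy; apply: eV => /=.
have /clVy[z [/= xz yz]] : nbhs y [set z | d y z < e / 2].
  by apply/dnbhs; exists (e / 2); rewrite ?divr_gt0.
by rewrite (le_lt_trans (dtri x z y))// (splitr e) ltrD// dsym.
Qed.

Lemma metrizable_hausdorff : metrizable R T -> hausdorff_space T.
Proof.
move=> /metrizable_nbhs[d [dge0 d0 dsym dtri] dnbhs] x y xy.
apply/d0/eqP; rewrite eq_le dge0 andbT; apply/ler_addgt0Pl => e e0.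
rewrite addr0; have nb w : nbhs w [set z | d w z < e / 2].
  by apply/dnbhs; exists (e / 2); rewrite ?divr_gt0.
have [z [/= xz yz]] := xy _ _ (nb x) (nb y).
by rewrite (le_trans (dtri x z y))// ltW// (splitr e) ltrD// dsym.
Qed.

Lemma separable_metrizable_second_countable :
  separable T -> metrizable R T -> @second_countable T.
Proof.
move=> [S cS dS] /metrizable_nbhs[d [dge0 d0 dsym dtri] dnbhs].
pose ball (p : T * nat) : set T := [set y | d p.1 y < p.2.+1%:R^-1].
exists (ball @` (S `*` setT)).
  by apply: (sub_countable (card_image_le _ _)); apply: countableX.
split=> [_ [[s n] _ <-]|x V /dnbhs[e e0 eV]].
  rewrite openE => y /= sy; apply/dnbhs; exists (n.+1%:R^-1 - d s y).
    by rewrite subr_gt0.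
  by move=> z /= yz; rewrite /ball/= (le_lt_trans (dtri s y z))// -ltrBrDl.
have [n ne] : exists n, n.+1%:R^-1 < e / 2.
  have [|n] := @ltr_add_invr R 0 (e / 2); first by rewrite divr_gt0.
  by rewrite add0r => ne; exists n.
have [s [xs Ss]] : [set y | d x y < n.+1%:R^-1]° `&` S !=set0.
  apply: dS; last exact: open_interior.
  by exists x; apply/dnbhs; exists n.+1%:R^-1.
have /= {}xs := interior_subset xs.
exists (ball (s, n)); first by split; [exists (s, n)|rewrite /ball/= dsym].
move=> y /= sy; apply: eV => /=; rewrite (le_lt_trans (dtri x s y))//.
by rewrite (splitr e) ltrD// (lt_trans _ ne).
Qed.

End Metrizable.

(** * Second countable spaces and Urysohn's metrization theorem *)

Lemma second_countable_seq (T : topologicalType) : @second_countable T ->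
  exists2 U : nat -> set T, forall n, open (U n) &
    forall x V, nbhs x V -> exists n, U n x /\ U n `<=` V.
Proof.
case=> B /countable_injP[f finj] [Bopen Bnbhs].
(* Since [f] numbers [B] injectively, each union has at most one member; an [n] that numbers no
   member gives the empty set. *)
exists (fun n => \bigcup_(b in [set b | B b /\ f b = n]) b).
  by move=> n; apply: bigcup_open => b [/Bopen].
move=> x V /Bnbhs[b [Bb bx] bV]; exists (f b); split; first by exists b.
by move=> y [c [Bc /finj]]; rewrite !inE => /(_ Bc Bb) ->; exact: bV.
Qed.

Lemma second_countable_prod (T U : topologicalType) :
  @second_countable T -> @second_countable U -> @second_countable (T * U)%type.
Proof.
move=> [B cB [Bopen Bnbhs]] [C cC [Copen Cnbhs]].
exists ((fun p => p.1 `*` p.2) @` (B `*` C)).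
  by apply: (sub_countable (card_image_le _ _)); apply: countableX.
split=> [_ [[b c] [/= /Bopen ob /Copen oc] <-]|[x y] V [[P Q] [Px Qy] PQV]].
  rewrite openE => -[x y] [/= bx cy].
  by exists (b, c) => //; split; apply: open_nbhs_nbhs.
have [b [Bb bx] bP] := Bnbhs x _ Px; have [c [Cc cy] cQ] := Cnbhs y _ Qy.
exists (b `*` c); first by split=> //; exists (b, c).
by move=> [z w] [/= bz cw]; apply: PQV; split; [exact: bP|exact: cQ].
Qed.

Lemma second_countable_image (T U : topologicalType) (f : T -> U) :
  continuous f -> (forall A, open A -> open (f @` A)) -> range f = setT ->
  @second_countable T -> @second_countable U.
Proof.
move=> cf fopen fsurj [B cB [Bopen Bnbhs]].
exists (image^~ f @` B); first exact: (sub_countable (card_image_le _ _)).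
split=> [_ [b Bb <-]|y V yV]; first exact/fopen/Bopen.
have [x _ fxy] : range f y by rewrite fsurj.
have [b [Bb bx] bV] : filter_from [set b | B b /\ b x] id (f @^-1` V).
  by apply: Bnbhs; apply: cf; rewrite fxy.
exists (f @` b); first by split; [exists b|exists x].
by move=> _ [z bz <-]; exact: bV.
Qed.

(** Tychonoff's argument: regularity covers [A] by countably many basic sets whose closures miss
    [B], and [B] likewise; the two countable covers are then made disjoint. *)
Lemma second_countable_regular_normal (R : realType) (T : topologicalType) :
  @second_countable T -> regular_space T -> normal_space T.
Proof.
move=> /second_countable_seq[U oU Unbhs] regT; apply/(@normal_openP R).
move=> A B clA clB AB0.
(* The second condition does not involve [x]: each [a n] is either [U n] or empty, and hence
   open. *)
pose a n := [set x | U n x /\ closure (U n) `&` B = set0].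
pose b n := [set x | U n x /\ closure (U n) `&` A = set0].
have aux (C : set T) n : open [set x | U n x /\ closure (U n) `&` C = set0].
  have [e|ne] := pselect (closure (U n) `&` C = set0).
    by rewrite (_ : [set x | _] = U n)//; apply/seteqP; split=> [x []|x].
  rewrite (_ : [set x | _] = set0); first exact: open0.
  by apply/seteqP; split=> [x []|x].
have cov (C D : set T) x : closed D -> C `&` D = set0 -> C x ->
    exists n, U n x /\ closure (U n) `&` D = set0.
  move=> clD CD Cx; have : nbhs x (~` D).
    apply: open_nbhs_nbhs; split; first exact: closed_openC.
    by move=> Dx; have : (C `&` D) x by []; rewrite CD.
  move=> /regT[V /Unbhs[n [Unx UV]] VD]; exists n; split=> //.
  by apply/disjoints_subset/(subset_trans _ VD); exact: closureS.
have cdisj (C : set T) n x :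
    closure [set x | U n x /\ closure (U n) `&` C = set0] x -> ~ C x.
  move=> cx Cx; have [y [[_ e] _]] := cx setT filterT.
  have clx : closure (U n) x by apply: closureS cx => z [].
  by have : (closure (U n) `&` C) x by []; rewrite e.
(* Removing from each [a n] the closures of the earlier [b m], and conversely,
   makes the two unions disjoint. *)
pose P n := a n `\` \bigcup_(m in `I_n.+1) closure (b m).
pose Q n := b n `\` \bigcup_(m in `I_n.+1) closure (a m).
have odiff (V : set T) (W : nat -> set T) n : open V ->
    open (V `\` \bigcup_(m in `I_n.+1) closure (W m)).
  move=> oV; rewrite setDE; apply: openI => //; apply: closed_openC.
  rewrite bigcup_mkord; apply: closed_bigsetU => m _.
  exact: closed_closure.
exists (\bigcup_n P n), (\bigcup_n Q n); split.
- by apply: bigcup_open => n _; exact/odiff/aux.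
- by apply: bigcup_open => n _; exact/odiff/aux.
- move=> x Ax; have [n anx] := cov A B x clB AB0 Ax.
  exists n => //; split=> //; move=> [m _ /cdisj]; exact.
- move=> x Bx; have [n bnx] := cov B A x clA (etrans (setIC _ _) AB0) Bx.
  exists n => //; split=> //; move=> [m _ /cdisj]; exact.
rewrite -subset0 => x [[n _ [anx nb]] [m _ [bmx na]]].
have [mn|/ltnW nm] := leqP m n.
  by apply: nb; exists m => //; exact: subset_closure.
by apply: na; exists n => //; exact: subset_closure.
Qed.

(** The metric is the supremum over [n] of [|f n x - f n y| / n.+1]. Separation makes its balls
    small; the decay of the weights makes them neighbourhoods, as only finitely many terms need
    continuity. *)
Lemma separating_metrizable (R : realType) (T : topologicalType)
    (f : nat -> T -> R) :
  (forall n, continuous (f n)) -> (forall n x, 0 <= f n x <= 1) ->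
  (forall x V, nbhs x V ->
    exists n, f n x = 0 /\ forall y, ~ V y -> f n y = 1) ->
  accessible_space T -> metrizable R T.
Proof.
move=> cf f01 fsep T1.
pose D x y : set R := [set `|f n x - f n y| / n.+1%:R | n in setT].
pose d x y := sup (D x y).
have f_le1 n x y : `|f n x - f n y| <= 1.
  by rewrite ler_norml; have := f01 n x; have := f01 n y; lra.
have D0 x y : D x y !=set0 by exists (`|f 0%N x - f 0%N y| / 1%:R), 0%N.
have Dub x y : has_ubound (D x y).
  exists 1 => _ [n _ <-]; rewrite ler_pdivrMr ?ltr0n// mul1r.
  by rewrite (le_trans (f_le1 n x y))// ler1n.
have d_ge x y n : `|f n x - f n y| / n.+1%:R <= d x y.
  by apply: ub_le_sup => //; exists n.
have d_le x y e : (forall n, `|f n x - f n y| / n.+1%:R <= e) -> d x y <= e.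
  by move=> h; apply: ge_sup => // _ [n _ <-].
have dge0 x y : 0 <= d x y.
  by rewrite (le_trans _ (d_ge x y 0%N))// divr_ge0.
have d_sep x V : nbhs x V -> exists2 e, 0 < e & [set y | d x y < e] `<=` V.
  move=> /fsep[n [fx0 fy1]]; exists n.+1%:R^-1; first by rewrite invr_gt0 ltr0n.
  move=> y /= xy; apply: contrapT => /fy1 fy.
  have := le_lt_trans (d_ge x y n) xy.
  by rewrite fx0 fy sub0r normrN normr1 mul1r ltxx.
exists d; first split=> //.
- move=> x y; split=> [dxy0|->]; last first.
    apply/eqP; rewrite eq_le dge0 andbT d_le// => n.
    by rewrite subrr normr0 mul0r.
  apply: contrapT => /eqP /T1[V [oV /set_mem Vx /set_mem nVy]].
  have [e e0 eV] := d_sep _ _ (open_nbhs_nbhs (conj oV Vx)).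
  by apply/nVy/eV; rewrite /= dxy0.
- by move=> x y; congr sup; apply/eq_imagel => n _; rewrite distrC.
- move=> x y z; apply: d_le => n.
  rewrite (le_trans _ (lerD (d_ge x y n) (d_ge y z n)))// -mulrDl.
  by rewrite ler_wpM2r// ?invr_ge0// ler_distD.
move=> A; split=> [oA x Ax|hA]; first exact/d_sep/open_nbhs_nbhs.
rewrite openE => x /hA[e e0 eA]; apply: filterS eA _.
(* Terms of index above [N] are below [e / 2] by their weight alone; the first [N.+1] terms are
   handled by continuity. The bound [e / 2] passes to the supremum and stays strictly below [e]. *)
have [N Ne] : exists N, N.+1%:R^-1 < e / 2.
  have [|n] := @ltr_add_invr R 0 (e / 2); first by rewrite divr_gt0.
  by rewrite add0r => ne; exists n.
have /(@filter_forall _ 'I_N.+1) : forall n : 'I_N.+1,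
    \forall y \near x, `|f n x - f n y| < e / 2.
  move=> n; have /cvgrPdist_lt := cf n x; apply; exact: divr_gt0.
apply: filterS => y fy /=.
rewrite (@le_lt_trans _ _ (e / 2))//; last by lra.
apply: d_le => n; have [nN|Nn] := ltnP n N.+1.
  rewrite ler_pdivrMr ?ltr0n// (le_trans (ltW (fy (Ordinal nN))))//.
  by rewrite ler_peMr ?ler1n// divr_ge0// ltW.
rewrite (le_trans _ (ltW Ne))// -[leRHS]mul1r ler_pM// ?invr_ge0//.
by rewrite lef_pV2 ?posrE ?ltr0n// ler_nat ltnW.
Qed.

Lemma urysohn_metrization (R : realType) (T : topologicalType) :
  @second_countable T -> regular_space T -> accessible_space T ->
  metrizable R T.
Proof.
move=> scT regT T1; have normT := second_countable_regular_normal R scT regT.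
have [U oU Unbhs] := second_countable_seq scT.
(* Here [n] codes a pair of basic sets. For a pair that is not separated, or the default pair, [f n]
   is still continuous with values in the unit interval. *)
pose f n :=
  let p := odflt (0, 0)%N (@unpickle (nat * nat)%type n) in
  @Urysohn T R (closure (U p.1)) (~` U p.2).
apply: (@separating_metrizable _ _ f) => //.
- by move=> n; exact: Urysohn_continuous.
- move=> n x; have : range (f n) (f n x) by exists x.
  by move=> /Urysohn_range; rewrite /= in_itv.
move=> x V /Unbhs[m [Umx UmV]].
have /regT[W /Unbhs[n [Unx UnW]] WU] : nbhs x (U m) by exact: open_nbhs_nbhs.
have sep : uniform_separator (closure (U n)) (~` U m).
  apply: (iffLR (@normal_separatorP R T)) => //; first exact: closed_closure.
    exact: open_closedC.
  by rewrite -subset0 => y [Uny]; apply; apply: WU; exact: closureS Uny.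
exists (pickle (n, m)); rewrite /f pickleK /=; split.
  by apply: (Urysohn_sub0 sep); exists x => //; exact: subset_closure.
by move=> y nVy; apply: (Urysohn_sub1 sep); exists y => // /UmV.
Qed.

Local Close Scope ring_scope.
Local Open Scope group_scope.
Local Open Scope quotient_scope.

(** * Limits of products and inverses in topological groups *)

Section TopologicalGroup.
Context {G : topologicalGroupType}.

Lemma cvg_mulg (T : Type) (F : set_system T) (FF : Filter F) (f g : T -> G)
    (a b : G) :
  f @ F --> a -> g @ F --> b -> (f x * g x) @[x --> F] --> a * b.
Proof.
move=> fa gb.
exact: cvg_comp (cvg_pair fa gb) (@mulg_continuous G (a, b)).
Qed.

Lemma cvg_invg (T : Type) (F : set_system T) (FF : Filter F) (f : T -> G)
    (a : G) :
  f @ F --> a -> (f x)^-1 @[x --> F] --> a^-1.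
Proof. by move=> fa; exact: cvg_comp fa (@invg_continuous G a). Qed.

End TopologicalGroup.

(** * Nice partial actions and uniform regularity *)

Section PartialAction.
Context {H : topologicalGroupType} {X : topologicalType}.
Variable theta : partial_action H X.

(** Openness of the domain turns continuity for its subspace topology into a statement about
    neighbourhoods in the whole product. *)
Lemma nice_paction_near k x V : nice_paction theta -> pdom theta (k, x) ->
  nbhs (pact theta k x) V ->
  \forall p \near (k, x), pdom theta p /\ V (pact theta p.1 p.2).
Proof.
move=> [/subspace_continuousP cont odom] kx nV.
have nkx : \forall p \near (k, x), pdom theta p -> V (pact theta p.1 p.2).
  exact: cont _ kx _ nV.
apply: filterS2 nkx (open_nbhs_nbhs (conj odom kx)) => p Vp dp.
by split=> //; exact: Vp.
Qed.

Lemma nice_paction_near_point k x V : nice_paction theta ->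
  pdom theta (k, x) -> nbhs (pact theta k x) V ->
  \forall y \near x, pdom theta (k, y) /\ V (pact theta k y).
Proof.
move=> nice kx /(nice_paction_near nice kx).
have : (k, y) @[y --> x] --> (k, x) by apply: cvg_pair; [exact: cvg_cst|].
by apply.
Qed.

(* The point is that [V0] does not depend on [k]. *)
Definition uniformly_regular_paction :=
  forall (x : X) V, nbhs x V -> exists2 V0, nbhs x V0 &
    forall k, closure [set y | pdom theta (k, y) /\ V0 (pact theta k y)] `<=`
      [set y | pdom theta (k, y) /\ V (pact theta k y)].

(** Take [V0] with closure inside [V]. Closedness of the domain lets [k] act on a limit point, and
    continuity puts the image in the closure of [V0]. *)
Lemma uniformly_regular_closed_dom : nice_paction theta -> regular_space X ->
  (forall k, closed [set y | pdom theta (k, y)]) -> uniformly_regular_paction.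
Proof.
move=> nice regX cldom x V /regX[V0 xV0 V0V]; exists V0 => // k y cly.
have ky : pdom theta (k, y) by apply: cldom; apply: closureS cly => z [].
split=> //; apply: V0V => B /(nice_paction_near_point nice ky)/cly.
by move=> [z [[_ V0z] [_ Bz]]]; exists (pact theta k z).
Qed.

(** A relation with closed graph has closed preimages of compact sets. Taking [V0] inside a compact
    set thus forces [k] to be defined at the limit point. *)
Lemma uniformly_regular_locally_compact : regular_space X ->
  locally_compact [set: X] -> closed (globalization_graph theta) ->
  uniformly_regular_paction.
Proof.
move=> regX lcX clR x V /regX[V1 xV1 V1V].
have [C xC [cC _]] : compact_near (within setT (nbhs x)) by exact: lcX.
exists (C `&` V1).
  apply: filterI => //.
  by apply: filterS (xC : \forall z \near x, setT z -> C z) => z; exact.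
move=> k y cly; apply: contrapT => nky.
have cCV : compact (C `&` closure V1).
  by apply: compact_closedI => //; exact: closed_closure.
(* The graph of [k], with coordinates swapped, is the slice of [globalization_graph theta] at the
   group elements [k] and [1]. *)
have clgraph : closed [set p : X * X |
    pdom theta (k, p.2) /\ pact theta k p.2 = p.1].
  rewrite (_ : [set p | _] =
    (fun p : X * X => ((k, p.2), (1, p.1))) @^-1` globalization_graph theta).
    apply: closed_comp => // -[w z] _.
    exact: cvg_pair (cvg_pair (cvg_cst _) cvg_snd)
      (cvg_pair (cvg_cst _) cvg_fst).
  apply/seteqP; split=> -[w z];
    by rewrite /globalization_graph/globalization_rel/Defs.pset/=
      invg1 mul1g mulg1 invgK.
have /compact_near_coveringP cov := cCV.
have nogr : forall w, (C `&` closure V1) w -> \forall w' \near w & z \near y,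
    ~ (pdom theta (k, z) /\ pact theta k z = w').
  move=> w [Cw V1w].
  apply: (@open_nbhs_nbhs _ (w, y)); split; first exact: closed_openC clgraph.
  by move=> [ky kyw]; apply: nky; split=> //; apply: V1V; rewrite kyw.
(* Tube lemma: a single neighbourhood of [y] avoids the graph over the whole compact set, yet [cly]
   finds in it a point that [k] sends into that set. *)
have [z [[kz [Cz V1z]] nz]] := cly _ (cov X (nbhs y)
  (fun z w => ~ (pdom theta (k, z) /\ pact theta k z = w)) _ nogr).
by apply: (nz (pact theta k z)) => //; split=> //; exact: subset_closure.
Qed.

End PartialAction.

(** * Topology of the twisted product *)

Section TwistedProduct.
Context {G : topologicalGroupType} {K : groupClosed G} {X : topologicalType}.
Variable theta : partial_action (subgroup_type K) X.

Local Notation Z := (twisted_product theta).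

Lemma twisted_piP (p q : G * X) :
  \pi_Z p = \pi_Z q <-> exists2 k, pdom theta (k, p.2) &
    q = (p.1 * (val k)^-1, pact theta k p.2).
Proof.
split=> [/(eqmodP (twisted_equiv theta))/asboolP[k kp <-]|[k kp ->]].
  by exists k.
by apply/(eqmodP (twisted_equiv theta))/asboolP; exists k.
Qed.

Hypothesis nice : nice_paction theta.

(** The projection is open: if [k] moves [(h, y)] into an open set, niceness lets the same [k] move
    all nearby points into it. *)
Lemma twisted_pi_nbhs (p : G * X) (N : set (G * X)) :
  nbhs p N -> nbhs (\pi_Z p) (\pi_Z @` N).
Proof.
rewrite nbhsE => -[W [oW Wp] WN].
suff oPiW : open (\pi_Z @` W).
  apply: filterS (open_nbhs_nbhs (conj oPiW _)); last by exists p.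
  exact: image_subset.
rewrite /open/= /quotient_open openE => -[h y] [q Wq].
move=> /esym/twisted_piP[k /= ky qE].
rewrite qE in Wq.
have : \forall q' \near (h, y), W (q'.1 * (val k)^-1, pact theta k q'.2) /\
    pdom theta (k, q'.2).
  have [[A B] /= [hA yB] ABW] := open_nbhs_nbhs (conj oW Wq).
  have hA' : \forall h' \near h, A (h' * (val k)^-1).
    have : (h' * (val k)^-1) @[h' --> h] --> h * (val k)^-1.
      by apply: cvg_mulg; [exact: cvg_id|exact: cvg_cst].
    by apply.
  exists ([set h' | A (h' * (val k)^-1)],
          [set y' | pdom theta (k, y') /\ B (pact theta k y')]).
    by split=> //=; exact: nice_paction_near_point.
  by move=> [h' y'] [/= Ah [ky' By]]; split=> //; exact: ABW.
apply: filterS => -[h' y'] /= [Wq' ky'].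
exists (h' * (val k)^-1, pact theta k y') => //.
by apply/esym/twisted_piP; exists k.
Qed.

Lemma twisted_second_countable : @second_countable G -> @second_countable X ->
  @second_countable Z.
Proof.
move=> scG scX; apply: (@second_countable_image (G * X)%type Z \pi_Z).
- exact: pi_continuous.
- move=> A oA; rewrite openE => _ [p Ap <-].
  by apply: twisted_pi_nbhs; exact: open_nbhs_nbhs.
- by apply/seteqP; split=> // z _; exists (repr z) => //; exact: reprK.
- exact: second_countable_prod.
Qed.

Lemma twisted_regular : uniformly_regular_paction theta -> regular_space Z.
Proof.
move=> ureg z V; rewrite -[z]reprK; case: (repr z) => g x {z} zV.
have [[U0 V1] /= [gU0 xV1] UV] : nbhs (g, x) (\pi_Z @^-1` V).
  exact: (@pi_continuous _ {eq_quot twisted_equiv theta}) zV.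
have [V0 xV0 V0V1] := ureg x V1 xV1.
have [x1 e1] := pact1 theta x.
(* Elements of [N] send all of [V2] into [V0]; this allows a varying [k] to be replaced by a fixed
   [k0]. *)
have [|[N V2] /= [N1 xV2] NV] := @nice_paction_near _ _ theta 1 x V0 nice x1.
  by rewrite e1.
have [M M1 MN] : exists2 M, nbhs (1 : G) M & val @^-1` M `<=` N.
  move: N1; rewrite nbhsE => -[_ [[M oM <-] M1] MN].
  by exists M => //; apply: open_nbhs_nbhs.
have [U1 gU1 [U1U0 U1M]] : exists2 U1, nbhs g U1 & U1 `<=` U0 /\
    forall u v, U1 u -> U1 v -> M (u^-1 * v).
  have : (p.1^-1 * p.2) @[p --> (g, g)] --> g^-1 * g.
    by apply: cvg_mulg; [apply: cvg_invg; exact: cvg_fst|exact: cvg_snd].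
  rewrite mulVg => /(_ _ M1)[[A B] /= [gA gB] ABM].
  exists (U0 `&` (A `&` B)); first by do 2 apply: filterI => //.
  by split=> [u []//|u v [_ [Au _]] [_ [_ Bv]]]; exact: (ABM (u, v)).
(* The factor [A] absorbs the error [h / h'] made when a nearby [h'] is replaced by [h], so that
   [h / k] itself lands in [U1]. *)
have [[A U] /= [A1 gU] AU] : nbhs (1 : G, g) [set p | U1 (p.1 * p.2)].
  by apply: mulg_continuous; rewrite /= mul1g.
exists (\pi_Z @` (U `*` V2)).
  by apply: twisted_pi_nbhs; exists (U, V2).
move=> w; rewrite -[w]reprK; case: (repr w) => h y {w} clw.
have near_y B : nbhs y B -> exists k z,
    [/\ U1 (h * (val k)^-1), B z, pdom theta (k, z) & V2 (pact theta k z)].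
  move=> yB; have : nbhs (h, y) ([set h' | A (h / h')] `*` B).
    exists ([set h' | A (h / h')], B) => //; split=> //=.
    have : (h / h') @[h' --> h] --> h / h.
      by apply: cvg_mulg; [exact: cvg_cst|exact: cvg_invg].
    by rewrite mulgV; apply.
  move=> /twisted_pi_nbhs/clw[_ [[[g' x'] [/= Ug V2x] <-] [[h' z] [/= Ah Bz]]]].
  move=> /twisted_piP[k /= kz [gE xE]]; exists k, z; split=> //.
    rewrite (_ : h / val k = (h / h') * g'); first exact: (AU (_, _)).
    by rewrite gE mulgA mulgVK.
  by rewrite -xE.
have [k0 [_ [U1k0 _ _ _]]] := near_y setT filterT.
have [k0y V1y] : pdom theta (k0, y) /\ V1 (pact theta k0 y).
  (* On [z], [k0] acts as [k] followed by [k0 / k], and [k0 / k] equals [(h / k0)^-1 * (h / k)],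
     which lies in [M]. *)
  apply: V0V1 => B /near_y[k [z [U1k Bz kz V2z]]].
  exists z; split=> //.
  have [|/= kkz V0z] := NV (k0 / k, pact theta k z).
    split=> //=; apply: MN => /=.
    have := U1M _ _ U1k0 U1k.
    by rewrite invgM invgK -mulgA mulKg.
  have [] := pactM kz kkz; rewrite mulgVK => dz ez.
  by split=> //; rewrite -ez.
rewrite (iffRL (twisted_piP (h, y) (h * (val k0)^-1, pact theta k0 y))).
  by apply: UV; split=> //; exact: U1U0.
by exists k0.
Qed.

(** Each class is closed: at a limit of its points the acting elements converge in [G], and
    closedness of the domain keeps their limit in [K] and able to act on [x]. *)
Lemma twisted_accessible : hausdorff_space X -> closed (pdom_in theta) ->
  accessible_space Z.
Proof.
move=> hX cldom; have cl1 (w : Z) : closed [set w].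
  rewrite -[w]reprK; case: (repr w) => g x {w}.
  rewrite -openC /open/= /quotient_open -preimage_setC openC => -[h y] cly.
  (* If [k] moves [(g, x)] to [(h', z)], then [val k] is [h'^-1 * g]: the acting element is a
     continuous function of [h']. *)
  have cdiv : (h' ^-1 * g) @[h' --> h] --> h^-1 * g.
    by apply: cvg_mulg; [exact: cvg_invg|exact: cvg_cst].
  have cls A B : nbhs (h^-1 * g) A -> nbhs y B -> exists k,
      [/\ A (val k), pdom theta (k, x) & B (pact theta k x)].
    move=> /cdiv hA yB.
    have /cly[[h' z] [/= /esym/twisted_piP[k /= kx [hE zE]] [/= hA' Bz]]] :
        nbhs (h, y) ([set h' | A (h'^-1 * g)] `*` B).
      by exists ([set h' | A (h'^-1 * g)], B).
    exists k; split=> //; last by rewrite -zE.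
    by move: hA'; rewrite hE invgM invgK mulgVK.
  have [[k0 x0] k0x [/= k0E x0E]] : pdom_in theta (h^-1 * g, x).
    apply: cldom => N [[A B] /= [hA xB] AB].
    have [k [Ak kx _]] := cls A setT hA filterT.
    exists (val k, x); split; first by exists (k, x).
    by apply: AB; split=> //; exact: nbhs_singleton.
  rewrite {}x0E in k0x.
  (* Both sides are limits of the same points [pact theta k x], with [val k] tending to [val k0]. *)
  have -> : y = pact theta k0 x.
    apply: hX => B C yB kC.
    have [[N W] /= [k0N xW] NW] := nice_paction_near nice k0x kC.
    move: k0N; rewrite nbhsE => -[_ [[M oM <-] Mk0] MN].
    have hM : nbhs (h^-1 * g) M by apply: open_nbhs_nbhs; rewrite -k0E.
    have [k [Mk kx Bk]] := cls M B hM yB.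
    exists (pact theta k x); split=> //.
    have [] := NW (k, x) => //; split=> //=; first exact: MN.
    exact: nbhs_singleton.
  apply/esym/twisted_piP; exists k0 => //=.
  by rewrite k0E invgM invgK mulVKg.
move=> w z /eqP wz; exists (~` [set z]); split; last by rewrite setCK inE.
  exact: closed_openC (cl1 z).
by rewrite inE.
Qed.

End TwistedProduct.

Theorem theorem3p9 (R : realType) (G : topologicalGroupType)
    (K : groupClosed G) (X : topologicalType)
    (theta : partial_action (subgroup_type K) X)
    (sepG : separable G) (metG : metrizable R G)
    (sepX : separable X) (metX : metrizable R X)
    (thetaX : is_Gspace theta) (nice : nice_paction theta) :
  closed (pdom_in theta) \/
  [/\ accessible_space (twisted_product theta),
      locally_compact [set: X] &
      closed (globalization_graph theta)] ->
  metrizable R (twisted_product theta).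
Proof.
have regX := metrizable_regular metX.
have scZ : @second_countable (twisted_product theta).
  apply: twisted_second_countable => //.
    exact: separable_metrizable_second_countable sepG metG.
  exact: separable_metrizable_second_countable sepX metX.
case=> [cldom|[T1 lcX clR]]; apply: urysohn_metrization => //.
- apply: twisted_regular => //; apply: uniformly_regular_closed_dom => // k.
  (* The closed set lives over [G], so the domain of [k] is obtained as its slice at [val k]. *)
  rewrite (_ : [set y | _] = (fun y => (val k, y)) @^-1` pdom_in theta).
    apply: closed_comp => // y _; exact: cvg_pair (cvg_cst _) cvg_id.
  apply/seteqP; split=> [y ky|y [[k' y'] ky' [/= /val_inj <- <-]]//].
  by exists (k, y).
- by apply: twisted_accessible => //; exact: metrizable_hausdorff metX.
- by apply: twisted_regular => //; exact: uniformly_regular_locally_compact.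
Qed.
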